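(* Assume that there are no measurable cardinals. Then there is a full subcategory of the category of abelian groups which is closed under products and retracts but is not weakly reflective.
   Context: Subcategories are assumed closed under isomorphisms. A full subcategory $\mathcal{L}$ of a category $\mathcal{T}$ is weakly reflective if for every object $X$ of $\mathcal{T}$ there is a morphism $l_X\colon X\to X^*$ with $X^*$ in $\mathcal{L}$ such that the function $\mathcal{T}(l_X,Y)\colon\mathcal{T}(X^*,Y)\to\mathcal{T}(X,Y)$ is surjective for all objects $Y$ of $\mathcal{L}$. *)

(* Defs.v *)
From mathcomp Require Import all_boot all_algebra.
From mathcomp Require Import boolp classical_sets functions cardinality filter.

Set Implicit Arguments.
Unset Strict Implicit.
Unset Printing Implicit Defensive.

Import GRing.Theory.

Local Open Scope classical_set_scope.
Local Open Scope card_scope.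

(* "Small" sets: the universe in which carriers of objects of [zmodType] live.
   The universe is named explicitly so that index sets of products and
   cardinals range over exactly the same sets as the carriers of abelian groups.
   If these universes were left to float, the statement could end up comparing
   groups, products and cardinals of different sizes. *)
Definition small := Type@{Algebra.Zmodule.axioms_.u0}.

(* A cardinal is represented by a small type [X] of that cardinality. *)

Definition nonprincipal (X : small) (F : set_system X) :=
  forall x : X, F <> principal_filter x.

(* Closure under intersections of fewer than |X| members. *)
Definition card_complete (X : small) (F : set_system X) :=
  forall D : set_system X, D `<=` F ->
    D #<= [set: X] -> D #!= [set: X] -> F (\bigcap_(A in D) A).

Definition measurable_cardinal (X : small) :=
  ~ countable [set: X] /\
  exists F : set_system X,
    [/\ UltraFilter F, nonprincipal F & card_complete F].

(* The category of abelian groups: the objects are the [zmodType]s and the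
   morphisms are the additive maps, compared pointwise.  The choice structure
   carried by a [zmodType] is irrelevant to morphisms.  A full
   subcategory is given by its class of objects [L : zmodType -> Prop]. *)

Definition ab_iso (A B : zmodType) :=
  exists (f : {additive A -> B}) (g : {additive B -> A}),
    cancel f g /\ cancel g f.

Definition iso_closed (L : zmodType -> Prop) :=
  forall A B : zmodType, ab_iso A B -> L A -> L B.

Definition ab_retract (A B : zmodType) :=
  exists (s : {additive A -> B}) (r : {additive B -> A}), cancel s r.

Definition retract_closed (L : zmodType -> Prop) :=
  forall A B : zmodType, ab_retract A B -> L B -> L A.

Definition ab_product (I : small) (A : I -> zmodType) (P : zmodType)
    (p : forall i, {additive P -> A i}) :=
  forall (Q : zmodType) (q : forall i, {additive Q -> A i}),
    exists h : {additive Q -> P},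
      (forall i, p i \o h =1 q i) /\
      forall h' : {additive Q -> P}, (forall i, p i \o h' =1 q i) -> h' =1 h.

Definition product_closed (L : zmodType -> Prop) :=
  forall (I : small) (A : I -> zmodType) (P : zmodType)
    (p : forall i, {additive P -> A i}),
    ab_product p -> (forall i, L (A i)) -> L P.

Definition weakly_reflective (L : zmodType -> Prop) :=
  forall X : zmodType, exists (Xs : zmodType) (l : {additive X -> Xs}),
    L Xs /\
    forall Y : zmodType, L Y ->
      forall f : {additive X -> Y}, exists g : {additive Xs -> Y}, g \o l =1 f.

(* Main.v *)
Require Import Defs.
From HB Require Import structures.
From mathcomp Require Import all_boot all_order all_algebra.
From mathcomp Require Import generic_quotient ring_quotient.
From mathcomp Require Import boolp classical_sets functions cardinality filter.
From mathcomp Require Import zify ring.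

(** The subcategory consists of the abelian groups [A] with [Hom(A, Z) = 0].
    Closure under isomorphisms and retracts is immediate.

    Closure under products rests on a theorem of Los
    ([functional_eq0_of_null_points]): in the absence of measurable cardinals,
    a homomorphism [psi : Z^I -> Z] that kills every function supported at a
    single point is zero.  Indeed, call [S] null if [psi] kills all functions
    supported in [S].  Specker's argument on homomorphisms out of [Z^nat]
    ([functional_kills_piece]) shows that the null sets are closed under
    countable unions and that a set which is not null contains an atom, that
    is, a set which is not null and cannot be cut into two sets which are not
    null.  The subsets that contain almost all of an atom form an ultrafilter,
    countably complete, and nonprincipal if points are null.  Such an
    ultrafilter yields a measurable cardinal: push it forward to the least
    cardinal of a family of its members whose intersection is not a member
    ([measurable_of_countably_complete]).
    For a product of groups [A i] without functionals, a functional [phi] and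
    an element [b], the theorem applies to [m |-> phi (i |-> m i * b i)].

    Suppose now that [l : Z -> B] is a weak reflection, so [Hom(B, Z) = 0].
    Choose a set [K] that is not the union of [|B * B|] subsets taken from a
    suitable ideal of small subsets containing the points, and let [G] be the
    quotient of [Z^K] by the functions with small support.  By the theorem of
    Los, [Hom(G, Z) = 0], so the diagonal map [Z -> G] factors as [g \o l] for
    some [g : B -> G].  Lift [g] to a map of sets [s : B -> Z^K].  Each of the
    [|B * B|] instances of additivity of [s] holds outside a small set, and so
    does the equation [s (l 1) = 1].  Hence some coordinate [k] avoids all the
    exceptional sets, and [b |-> s b k] is a homomorphism [B -> Z] that sends
    [l 1] to [1], a contradiction. *)

Set Implicit Arguments.
Unset Strict Implicit.
Unset Printing Implicit Defensive.

Import Order.TTheory GRing.Theory Num.Theory.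
Local Open Scope classical_set_scope.
Local Open Scope card_scope.
Local Open Scope ring_scope.
Local Open Scope quotient_scope.

Lemma additive_of (A B : zmodType) (f : A -> B) :
  zmod_morphism f -> exists F : {additive A -> B}, F = f :> (A -> B).
Proof.
move=> fB; pose m := GRing.isZmodMorphism.Build A B f fB.
by exists (HB.pack_for {additive A -> B} f m).
Qed.

(** * Specker's argument *)

Definition piece (I : Type) (r : I -> nat) (x : I -> int) (n : nat) :
  I -> int := fun i => if r i == n then x i else 0.

Section Specker.
Variables (I : Type) (psi : {additive (I -> int) -> int}).
Variables (r : I -> nat) (x : I -> int).

Let c (n : nat) : int := psi (piece r x n).

(* The weights grow so fast, in the divisibility order, that m k.+1 does not
   divide m k * c k. *)
Let m (n : nat) : int := \prod_(k < n) (2 * c k).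

Let y (eps : nat -> bool) : I -> int :=
  fun i => m (r i) * x i * (eps (r i))%:R.

Let m_neq0 n : (forall k, c k != 0) -> m n != 0.
Proof. by move=> c0; apply/prodf_neq0 => k _; rewrite mulf_neq0. Qed.

Let mS n : m n.+1 = m n * (2 * c n).
Proof. by rewrite /m big_ord_recr. Qed.

Let m_dvd n k : (m n %| m (n + k)%N)%Z.
Proof.
elim: k => [|k IH]; first by rewrite addn0 dvdzz.
by rewrite addnS mS dvdz_mulr.
Qed.

Let psiZ (a : int) (z : I -> int) : psi (fun i => a * z i) = a * psi z.
Proof.
have -> : (fun i => a * z i) = z *~ a.
  apply/funext => i.
  have [ev evE] : exists ev : {additive (I -> int) -> int},
      ev = (@^~ i) :> (_ -> _) by exact: additive_of.
  have := raddfMz ev a z; rewrite evE => ->.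
  by rewrite -mulrzl intz.
by rewrite raddfMz -mulrzl intz.
Qed.

(** If [k] is the first index at which the two sequences differ, then
    [psi (y eps) - psi (y eps')] is [m k * c k] up to sign, modulo [m k.+1],
    and [m k.+1] is twice [m k * c k]. *)
Let first_difference eps eps' k : (forall j, c j != 0) ->
  (forall j, (j < k)%N -> eps j = eps' j) -> eps k != eps' k ->
  psi (y eps) != psi (y eps').
Proof.
move=> c0 agree diff; apply/eqP => /eqP.
rewrite -subr_eq0 -raddfB => /eqP psi0.
pose s : int := (eps k)%:R - (eps' k)%:R.
have s1 : `|s| = 1 by rewrite /s; case: (eps k) (eps' k) diff => [] [].
pose z i : int := if (k < r i)%N then
  (m (r i) %/ m k.+1)%Z * x i * ((eps (r i))%:R - (eps' (r i))%:R) else 0.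
have decomp i : y eps i - y eps' i = s * m k * piece r x k i + m k.+1 * z i.
  rewrite /y /piece /z.
  have [lt_k|gt_k|eq_k] := ltngtP (r i) k.
  - by rewrite agree // mulr0 mulr0 subrr addr0.
  - have /divzK mE : (m k.+1 %| m (r i))%Z by rewrite -(subnKC gt_k) m_dvd.
    rewrite mulr0 add0r -{1 2}mE; ring.
  - by rewrite eq_k mulr0 addr0 /s; ring.
have {decomp psi0} : psi ((fun i => s * m k * piece r x k i) +
                          (fun i => m k.+1 * z i)) = 0.
  by rewrite -psi0; congr (psi _); apply/funext => i; rewrite -[LHS]decomp.
rewrite raddfD /= !psiZ -/(c k).
rewrite mS => /eqP.
have -> : s * m k * c k + m k * (2 * c k) * psi z =
          m k * c k * (s + 2 * psi z) by ring.
(* The last factor is odd. *)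
rewrite !mulf_eq0 (negPf (m_neq0 _ c0)) (negPf (c0 k)) /= => /eqP.
move: s1; lia.
Qed.

(** Otherwise [first_difference] makes [eps |-> psi (y eps)] an injection of
    the uncountable set [nat -> bool] into the integers. *)
Lemma functional_kills_piece : exists n, psi (piece r x n) = 0.
Proof.
apply: contrapT => /forallNP cN.
have c0 k : c k != 0 by apply/eqP/cN.
pose code eps := pickle (psi (y eps)).
have code_inj eps eps' : code eps = code eps' -> eps = eps'.
  move=> /(pcan_inj pickleK) E; apply: contrapT => ne.
  have exk : exists k, eps k != eps' k.
    apply: contrapT => /forallNP A; apply/ne/funext => k.
    exact/eqP/negPn/negP/A.
  case: (ex_minnP exk) => k kd kmin.
  suff /eqP: psi (y eps) != psi (y eps') by [].
  apply: (@first_difference eps eps' k) => // j jk.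
  by apply/eqP/negPn/negP => /kmin; rewrite leqNgt jk.
pose diag n := `[< forall eps, code eps = n -> ~~ eps n >].
case: (boolP (diag (code diag))) => [d|nd].
  by have /asboolP/(_ diag erefl) := d; rewrite d.
by case: (negP nd); apply/asboolP => eps /code_inj ->.
Qed.

End Specker.

(** * Null sets of a functional *)

Definition null (I : Type) (psi : (I -> int) -> int) (S : set I) :=
  forall x : I -> int, (forall i, ~ S i -> x i = 0) -> psi x = 0.

Section NullSets.
Variables (I : Type) (psi : {additive (I -> int) -> int}).
Local Notation null := (null psi).

Lemma null_subset (S T : set I) : S `<=` T -> null T -> null S.
Proof. by move=> ST nT x xS; apply: nT => i nTi; apply: xS => /ST. Qed.

Lemma null0 : null set0.
Proof.
move=> x x0; suff -> : x = 0 by rewrite raddf0.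
by apply/funext => i; apply: x0.
Qed.

(** Let [r] choose for each point of the support of [x] a null set containing
    it.  Discarding the points with [r i < k] does not change [psi x].  The
    infinite sums [\sum_k m k * tail k] are finite at each coordinate, so they
    define a functional of [m : nat -> int] whose value at every unit vector
    is [psi x]; by Specker's argument this value is zero. *)
Lemma null_bigcup (S : nat -> set I) :
  (forall n, null (S n)) -> null (\bigcup_n S n).
Proof.
move=> nS x xS; apply: contrapT => psix.
have [r rP] : {r : I -> nat & forall i, x i != 0 -> S (r i) i}.
  apply: (@choice I nat (fun i n => x i != 0 -> S n i)) => i.
  have [[n _ Sni]|/xS ->] := pselect ((\bigcup_n S n) i); first by exists n.
  by exists 0%N; rewrite eqxx.
pose tail k : I -> int := fun i => if (k <= r i)%N then x i else 0.
have psi_tail k : psi (tail k) = psi x.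
  elim: k => [|k IH]; first by congr (psi _); apply/funext => i.
  rewrite -IH; apply/esym/eqP; rewrite -subr_eq0 -raddfB; apply/eqP.
  apply: (nS k) => i nSki; rewrite /tail.
  change ((if (k <= r i)%N then x i else 0) -
          (if (k < r i)%N then x i else 0) = 0).
  have [|_|ri] := ltngtP k (r i); rewrite ?subrr //.
  by rewrite subr0; apply/eqP/negPn/negP => /rP; rewrite -ri.
pose theta (m : nat -> int) := psi (fun i => x i * \sum_(k < (r i).+1) m k).
have thetaB : zmod_morphism theta.
  move=> a b; rewrite /theta -raddfB; congr (psi _); apply/funext => i.
  by rewrite [LHS]/= sumrB mulrBr.
have [F FE] := additive_of thetaB.
have [n] := functional_kills_piece F id (fun=> 1).
rewrite FE => theta0; apply: psix; rewrite -(psi_tail n) -theta0 /theta.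
congr (psi _); apply/funext => i; rewrite /tail /piece.
case: leqP => [ni|ni].
  rewrite (bigD1 (Ordinal (ni : (n < (r i).+1)%N))) //= eqxx big1.
    by rewrite addr0 mulr1.
  by move=> j; rewrite -val_eqE /= => /negPf ->.
rewrite big1 ?mulr0 // => j _; case: eqP => // jn.
by have := ltn_ord j; rewrite jn ltnS leqNgt ni.
Qed.

Lemma nullU (S T : set I) : null S -> null T -> null (S `|` T).
Proof.
move=> nS nT.
have /null_bigcup : forall n, null (if n is 0%N then S else T) by case.
by apply: null_subset => i [Si|Ti]; [exists 0%N|exists 1%N].
Qed.

(** Without an atom, one can split off forever: this produces disjoint sets
    [T n], none of them null.  Gluing functions [a n] supported in [T n] with
    [psi (a n) <> 0] contradicts Specker's argument. *)
Lemma null_atom : ~ null setT ->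
  exists2 S, ~ null S & forall T, null (S `&` T) \/ null (S `\` T).
Proof.
move=> nnT; apply: contrapT => noatom.
have [g gP] : {g : set I -> set I & forall S, ~ null S ->
    ~ null (S `&` g S) /\ ~ null (S `\` g S)}.
  apply: (@choice _ _ (fun S T =>
    ~ null S -> ~ null (S `&` T) /\ ~ null (S `\` T))) => S.
  apply: contrapT => /forallNP nogood; apply: noatom.
  exists S => [nS|T]; first by apply: (nogood set0).
  apply: contrapT => /not_orP bad; exact: (nogood T).
pose S n := iter n (fun S => S `\` g S) setT.
pose T n := S n `&` g (S n).
have SN n : ~ null (S n) by elim: n => //= n /gP[].
have {gP}TN n : ~ null (T n) by have /gP[] := SN n.
have TE m n i : T m i -> T n i -> m = n.
  wlog lt_mn : m n / (m < n)%N => [wl Tm Tn|[_ gm] [Sn _]].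
    by have [mn|nm|//] := ltngtP m n; [exact: wl|apply/esym/wl].
  have S_decr k : S (m.+1 + k)%N `<=` S m.+1.
    by elim: k => [|k IH]; [rewrite addn0|rewrite addnS => j [/IH]].
  by case: (S_decr (n - m.+1)%N i); rewrite ?subnKC //.
have [a aP] : {a : nat -> I -> int & forall n,
    (forall i, ~ T n i -> a n i = 0) /\ psi (a n) <> 0}.
  apply: (@choice _ _ (fun n b =>
    (forall i, ~ T n i -> b i = 0) /\ psi b <> 0)) => n.
  apply: contrapT => /forallNP A; apply: (TN n) => b bT.
  by apply: contrapT => ?; apply: (A b).
have [r rP] : {r : I -> nat & forall i, (exists n, T n i) -> T (r i) i}.
  apply: (@choice I nat (fun i n => (exists n, T n i) -> T n i)) => i.
  have [[n Tn]|no] := pselect (exists n, T n i); first by exists n.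
  by exists 0%N => /no.
have [n] := functional_kills_piece psi r (fun i => a (r i) i).
suff -> : piece r (fun i => a (r i) i) n = a n by case: (aP n).
apply/funext => i; rewrite /piece; case: eqP => [->//|rn].
rewrite (aP n).1 // => Tni; apply: rn; apply: (TE _ _ i) => //.
by apply: rP; exists n.
Qed.

End NullSets.

(** * The ultrafilter of an atom *)

Lemma ultrafilter_of_decides (T : Type) (F : set_system T) :
  ProperFilter F -> (forall A, F A \/ F (~` A)) -> UltraFilter F.
Proof.
move=> FP dec; split=> // G GP FG; apply/seteqP; split=> // A GA.
have [//|/FG GnA] := dec A; exfalso; apply: (@filter_not_empty _ G).
by rewrite -(setICr A); apply: filterI.
Qed.

Definition countably_complete (T : Type) (F : set_system T) :=
  forall D : set_system T, countable D -> D `<=` F -> F (\bigcap_(A in D) A).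

Definition conull (I : Type) (psi : (I -> int) -> int) (S : set I) :
  set_system I := [set T | null psi (S `\` T)].

Section Conull.
Variables (I : Type) (psi : {additive (I -> int) -> int}) (S : set I).

Lemma conull_complete : countably_complete (conull psi S).
Proof.
move=> D /countable_injP[f f_inj] DF; rewrite /conull /=.
pose B n := [set i | exists A, [/\ D A, f A = n, S i & ~ A i]].
have /(@null_bigcup _ psi) : forall n, null psi (B n).
  move=> n; have [[A [DA fA]]|no] := pselect (exists A, D A /\ f A = n).
    apply: null_subset (DF A DA) => i [A' [DA' fA' Si nA]]; split=> //.
    by rewrite (f_inj A A') ?inE ?fA ?fA'.
  by apply: null_subset (null0 psi) => i [A [DA fA _ _]]; apply: no; exists A.
apply: null_subset => i [Si nD].
have [A DA nA] : exists2 A, D A & ~ A i.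
  apply: contrapT => A; apply: nD => E DE.
  by apply: contrapT => ?; apply: A; exists E.
by exists (f A) => //; exists A.
Qed.

Lemma conull_ultra : ~ null psi S ->
  (forall T, null psi (S `&` T) \/ null psi (S `\` T)) ->
  UltraFilter (conull psi S).
Proof.
move=> SN S_atom; apply: ultrafilter_of_decides => [|A].
  split; first by rewrite /conull /= setD0.
  split.
  - by rewrite /conull /= setDT; exact: null0.
  - by move=> A B; rewrite /conull /= => nA nB; rewrite setDIr; apply: nullU.
  - move=> A B AB; apply: null_subset; exact: setDS.
by have [?|?] := S_atom A; [right|left] => //; rewrite /conull /= setDE setCK.
Qed.

End Conull.

(** * Measurable cardinals from countably complete ultrafilters *)

Lemma card_le_inj (T U : Type) (A : set T) (B : set U) (f : T -> U) :
  set_fun A B f -> set_inj A f -> A #<= B.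
Proof.
move=> fAB f_inj; have [g] := injfunPex.2 (ex_intro2 _ _ f fAB f_inj).
exact: inj_card_le.
Qed.

(** Cardinals are well-founded, by Honig's argument.  Consider sets [M] of
    choice functions [s], with [s E] in [E] for all members [E] of [C], any
    two of which differ at every member of [C].  If [M] is maximal, then
    evaluation of the elements of [M] at some member [D] covers [D], since
    otherwise a choice function could be added to [M]; as evaluation at any
    other member is injective on [M], this [D] has least cardinality. *)
Lemma card_minimum (T : Type) (C : set (set T)) : C !=set0 ->
  exists2 D, C D & forall E, C E -> D #<= E.
Proof.
move=> [E0 CE0].
pose P : set (set (set T -> T)) := [set M |
  (forall s E, M s -> C E -> E (s E)) /\
  forall s t E, M s -> M t -> C E -> s E = t E -> s = t].
have [F FP totF|M [[Msel Minj] Mmax]] := @Zorn_bigcup _ P.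
  split=> [s E [M FM Ms]|s t E [M FM Ms] [N FN Nt]]; first exact: (FP M FM).1.
  have [MN|NM] := totF M N FM FN.
    exact: ((FP N FN).2 s t E (MN _ Ms) Nt).
  exact: ((FP M FM).2 s t E Ms (NM _ Nt)).
suff [D CD Dcov] : exists2 D, C D & D `<=` [set s D | s in M].
  exists D => // E CE.
  have [pick pickP] : {p : T -> set T -> T &
      forall y, D y -> M (p y) /\ p y D = y}.
    apply: (@choice _ _ (fun y s => D y -> M s /\ s D = y)) => y.
    have [/Dcov[s Ms sy]|nDy] := pselect (D y); first by exists s.
    by exists (fun=> y) => /nDy.
  apply: (@card_le_inj _ _ _ _ (fun y => pick y E)) => [y /pickP[My _]|y z].
    exact: (Msel _ E My CE).
  rewrite !inE => /pickP[My yD] /pickP[Mz zD] yz.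
  by rewrite -yD -zD (Minj _ _ E My Mz CE yz).
apply: contrapT => nocov.
have missed E : C E -> exists2 y, E y & forall s, M s -> s E <> y.
  move=> CE; apply: contrapT => A; apply: nocov; exists E => // y Ey.
  apply: contrapT => B; apply: A; exists y => // s Ms sy.
  by apply: B; exists s.
have [y0 _ _] := missed E0 CE0.
have [u uP] : {u : set T -> T &
    forall E, C E -> E (u E) /\ forall s, M s -> s E <> u E}.
  apply: (@choice _ _ (fun E y => C E ->
    E y /\ forall s, M s -> s E <> y)) => E.
  have [/missed[y Ey yM]|nCE] := pselect (C E); first by exists y.
  by exists y0 => /nCE.
apply: (Mmax (M `|` [set u])).
  split=> [s|/(_ u (or_intror erefl)) Mu]; first by left.
  by have [_ /(_ u Mu)] := uP E0 CE0.
split=> [s E [Ms|->] CE|s t E [Ms|->] [Mt|->] CE] //.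
- exact: (Msel s E Ms CE).
- by have [] := uP E CE.
- exact: (Minj s t E Ms Mt CE).
- by have [_ /(_ s Ms)] := uP E CE.
- by have [_ /(_ t Mt) + /esym] := uP E CE.
Qed.

(** Let [D] be a family of members of [U], of least cardinality among those
    whose intersection is not a member.  Send a point [i] outside the
    intersection to some [A] in [D] that misses [i].  The image ultrafilter
    [V] on [D] is complete for families smaller than [D], by minimality; it is
    nonprincipal, since outside the intersection the fibre over [A] misses
    the member [A] of [U]; and [D] is uncountable by countable
    completeness. *)
Lemma measurable_of_countably_complete (I : small) (U : set_system I) :
  UltraFilter U -> nonprincipal U -> countably_complete U ->
  exists X : small, measurable_cardinal X.
Proof.
move=> UU Unp Ucc.
pose C : set (set_system I) :=
  [set D | D `<=` U /\ ~ U (\bigcap_(A in D) A)].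
have U_co i : U (~` [set i]).
  have [Ui|//] := in_ultra_setVsetC [set i] UU.
  exfalso; apply: (Unp i).
  apply: (@max_filter _ _ (principal_filter_ultra i)) => A.
  by move=> /principal_filterP Ai; apply: filterS Ui => _ ->.
have [D [DU nUD] Dmin] : exists2 D, C D & forall E, C E -> D #<= E.
  apply: card_minimum; exists [set ~` [set i] | i in [set: I]].
  split=> [_ [i _ <-]//|].
  suff -> : \bigcap_(A in [set ~` [set i] | i in [set: I]]) A = set0.
    exact: filter_not_empty.
  by apply/seteqP; split=> // i /(_ (~` [set i])); apply=> //; exists i.
have [A0 DA0] : D !=set0.
  apply/set0P/eqP => D0; apply: nUD; rewrite D0 bigcap_set0.
  exact: filterT.
pose X : small := D.
have := card_setT D; rewrite card_eq_le => /andP[X_le_D D_le_X].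
have [f fP] : {f : I -> X &
    forall i, ~ (\bigcap_(A in D) A) i -> ~ (val (f i)) i}.
  apply: (@choice I X (fun i x =>
    ~ (\bigcap_(A in D) A) i -> ~ (val x) i)) => i.
  have [iD|/existsNP[A /not_implyP[DA nAi]]] :=
    pselect ((\bigcap_(A in D) A) i).
    by exists (SigSub (mem_set DA0)).
  by exists (SigSub (mem_set DA)).
pose V : set_system X := [set B | U (f @^-1` B)].
exists X; split.
  move=> Xc; apply: nUD; apply: Ucc => //; exact: sub_countable D_le_X Xc.
exists V; split.
- apply: ultrafilter_of_decides => B.
  exact: (in_ultra_setVsetC (f @^-1` B)).
- move=> x VA; have DA := set_mem (valP x).
  have : U (f @^-1` [set x]).
    by change (V [set x]); rewrite VA; apply/principal_filterP.
  have [//|UnD] := in_ultra_setVsetC (\bigcap_(A in D) A) UU.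
  move=> /(filterI (DU _ DA))/(filterI UnD).
  suff -> : ~` (\bigcap_(A in D) A) `&` (val x `&` f @^-1` [set x]) = set0.
    exact: filter_not_empty.
  by apply/seteqP; split=> // i [/fP nfi [Ai fi]]; apply: nfi; rewrite fi.
- move=> E EV E_le E_ne; rewrite /V /= preimage_bigcap.
  apply: contrapT => nUE.
  have : D #<= [set f @^-1` B | B in E].
    apply: Dmin; split=> [_ [B EB <-]|]; first exact: EV.
    by rewrite bigcap_image.
  move=> DE; move/negP: E_ne; apply.
  rewrite card_eq_le E_le /=.
  apply: card_le_trans X_le_D (card_le_trans DE _).
  exact: card_image_le.
Qed.

(** The theorem of Los: if [psi] is not zero, the ultrafilter of an atom of
    [psi] is countably complete, and it is nonprincipal because an atom [S]
    with [S `\` [set i]] null would itself be null. *)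
Theorem functional_eq0_of_null_points (I : small)
    (psi : {additive (I -> int) -> int}) :
  ~ (exists X : small, measurable_cardinal X) ->
  (forall i, null psi [set i]) -> forall x, psi x = 0.
Proof.
move=> no_measurable null1 x.
suff nT : null psi setT by apply: nT => i nTi; exfalso; exact: nTi.
apply: contrapT => /null_atom[S SN S_atom]; apply: no_measurable.
apply: (@measurable_of_countably_complete I (conull psi S)).
- exact: conull_ultra.
- move=> i conullE; apply: SN.
  have : conull psi S [set i] by rewrite conullE; apply/principal_filterP.
  move=> /(nullU (null1 i)); apply: null_subset => j Sj.
  by have [->|] := pselect (j = i); [left|right].
- exact: conull_complete.
Qed.

(** * Groups without functionals *)

Definition no_functional (A : zmodType) :=
  forall (f : {additive A -> int}) a, f a = 0.

Lemma no_functional_iso : iso_closed no_functional.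
Proof.
move=> A B [f [g [_ fK]]] LA h b.
by rewrite -(fK b) -[h _]/((h \o f) (g b)) LA.
Qed.

Lemma no_functional_retract : retract_closed no_functional.
Proof.
move=> A B [s [r sK]] LB h a.
by rewrite -(sK a) -[h _]/((h \o r) (s a)) LB.
Qed.

(** A named copy of the dependent function type, so that its group structure
    does not compete with the one on functions with values in one group. *)
Definition dprod (I : Type) (A : I -> zmodType) : Type := forall i, A i.

Section DependentProduct.
Variables (I : Type) (A : I -> zmodType).
Implicit Types f g h : dprod A.

HB.instance Definition _ := gen_eqMixin (dprod A).
HB.instance Definition _ := gen_choiceMixin (dprod A).

Let add f g : dprod A := fun i => f i + g i.
Let opp f : dprod A := fun i => - f i.
Let zero : dprod A := fun i => 0.

Let addA : associative add.
Proof.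
by move=> f g h; apply/functional_extensionality_dep => i; apply: addrA.
Qed.

Let addC : commutative add.
Proof.
by move=> f g; apply/functional_extensionality_dep => i; apply: addrC.
Qed.

Let add0 : left_id zero add.
Proof.
by move=> f; apply/functional_extensionality_dep => i; apply: add0r.
Qed.

Let addN : left_inverse zero opp add.
Proof.
by move=> f; apply/functional_extensionality_dep => i; apply: addNr.
Qed.

HB.instance Definition _ :=
  GRing.isZmodule.Build (dprod A) addA addC add0 addN.

Definition dproj (i : I) (f : dprod A) : A i := f i.

Lemma dproj_is_zmod_morphism i : zmod_morphism (dproj i).
Proof. by []. Qed.

HB.instance Definition _ i := GRing.isZmodMorphism.Build (dprod A) (A i)
  (dproj i) (dproj_is_zmod_morphism i).

End DependentProduct.

Lemma no_functional_product :
  ~ (exists X : small, measurable_cardinal X) -> product_closed no_functional.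
Proof.
move=> no_measurable I A P p Pprod LA phi a.
(* By the universal property, P is a retract of the function group, so it
   suffices to evaluate phi on the image of a family b. *)
have [h [hp _]] := Pprod _ (fun i => (dproj i : {additive dprod A -> A i})).
have [k kE] : exists k : {additive P -> dprod A},
    k = (fun b i => p i b) :> (_ -> _).
  apply: additive_of => b c; apply/functional_extensionality_dep => i.
  exact: raddfB.
have hk b : h (k b) = b.
  have [u [up uniq]] := Pprod _ p.
  transitivity (u b); last by apply/esym/(uniq idfun).
  by apply: (uniq (h \o k)) => i c; rewrite /= [LHS]hp kE.
rewrite -(hk a); set b := k a.
have [psi psiE] : exists psi : {additive (I -> int) -> int},
    psi = (fun m : I -> int => phi (h (fun i => b i *~ m i))) :> (_ -> _).
  apply: additive_of => m n; rewrite -!raddfB; congr (phi (h _)).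
  by apply/functional_extensionality_dep => i; exact: mulrzBr.
have -> : phi (h b) = psi (fun=> 1) by rewrite psiE.
apply: functional_eq0_of_null_points => // i m mi; rewrite psiE.
(* On functions supported at i, psi factors through A i. *)
pose single (c : A i) : dprod A := fun j =>
  match pselect (i = j) with left e => eq_rect i A c j e | right _ => 0 end.
have singleB : zmod_morphism single.
  move=> c d; apply/functional_extensionality_dep => j.
  change (single (c - d) j = single c j - single d j); rewrite /single.
  by case: pselect => [e|_]; [case: _ / e|rewrite subrr].
have [s sE] := additive_of singleB.
rewrite -[RHS](LA i (phi \o h \o s) (b i *~ m i)) /= sE.
congr (phi (h _)); apply/functional_extensionality_dep => j; rewrite /single.
case: pselect => [e|ne]; first by case: _ / e.
by rewrite mi ?mulr0z // => ij; apply: ne.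
Qed.

(** * Reduced powers of the integers *)

Section Few.
Variables (A K : Type).

(** The bound is the cardinal [t ^ aleph_0] with [t = |bool + A|], so that
    unions of [t] sets subject to the bound obey it as well: an element of
    [nat -> bool + A] has room for an index in [bool + A] together with
    another element of [nat -> bool + A].  The summand [bool] provides two
    distinct indices. *)
Definition few (S : set K) := exists e : K -> (nat -> bool + A), set_inj S e.

Lemma few_subset (S S' : set K) : S `<=` S' -> few S' -> few S.
Proof.
move=> SS' [e e_inj]; exists e.
by apply: sub_in2 e_inj => k; rewrite !inE => /SS'.
Qed.

Lemma few1 k : few [set k].
Proof. by exists (fun=> fun=> inl true) => x y; rewrite !inE => -> ->. Qed.

Lemma few_bigcup (S : bool + A -> set K) :
  (forall t, few (S t)) -> few (\bigcup_t S t).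
Proof.
move=> /choice[e e_inj].
have [t tP] : {t : K -> bool + A & forall k, (\bigcup_t S t) k -> S (t k) k}.
  apply: (@choice _ _ (fun k t => (\bigcup_t S t) k -> S t k)) => k.
  have [[t _ Stk]|nS] := pselect ((\bigcup_t S t) k); first by exists t.
  by exists (inl true) => /nS.
exists (fun k n => if n is n'.+1 then e (t k) k n' else t k) => k l.
rewrite !inE => /tP Sk /tP Sl kl.
have tkl : t k = t l by have := congr1 (@^~ 0%N) kl.
apply: (e_inj (t k)); rewrite ?inE ?{2}tkl //; first by rewrite tkl.
by apply/funext => n; have := congr1 (@^~ n.+1) kl; rewrite /= -tkl.
Qed.

Lemma fewU (S S' : set K) : few S -> few S' -> few (S `|` S').
Proof.
move=> fS fS'.
have /few_bigcup : forall t : bool + A, few (if t is inl true then S else S').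
  by case=> [[]|].
by apply: few_subset => k [Sk|Sk]; [exists (inl true)|exists (inl false)].
Qed.

Definition few_support : {pred K -> int} :=
  [pred x | `[< few [set k | x k <> 0] >]].

Lemma few_support_closed : zmod_closed few_support.
Proof.
split=> [|x y]; rewrite !inE.
  by exists (fun=> fun=> inl true) => k; rewrite inE.
move=> fx fy; apply: few_subset (fewU fx fy) => k /= xyk.
have [x0|] := pselect (x k = 0); last by left.
right=> y0; apply: xyk.
by rewrite -[LHS]/(x k - y k) x0 y0 subrr.
Qed.

HB.instance Definition _ :=
  GRing.isZmodClosed.Build (K -> int) few_support few_support_closed.

Definition reduced_power : zmodType :=
  Quotient.quot (few_support : zmodClosed (K -> int)).

Definition reduce : (K -> int) -> reduced_power := \pi.

Lemma reduce_is_zmod_morphism : zmod_morphism reduce.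
Proof. exact: raddfB. Qed.

HB.instance Definition _ := GRing.isZmodMorphism.Build
  (K -> int) reduced_power reduce reduce_is_zmod_morphism.

Lemma reduce_surj q : exists x, reduce x = q.
Proof. by exists (repr q); exact: reprK. Qed.

Lemma reduce_eq0 x : reduce x = 0 <-> few [set k | x k <> 0].
Proof.
have -> : reduce x = 0 <-> (x - 0 \in few_support).
  by rewrite Quotient.idealrBE -/reduced_power; split => [/eqP|/eqP];
     rewrite raddf0.
by rewrite subr0 inE.
Qed.

End Few.

(** Cantor's diagonal argument: a power set as index set ensures that
    the union of few exceptional sets leaves out some coordinate. *)
Lemma not_few_powerset A : ~ few A [set: set (nat -> bool + A)].
Proof.
move=> [e e_inj]; pose D := [set w | exists2 X, e X = w & ~ X w].
have [De|nDe] := pselect (D (e D)); last by apply: (nDe); exists D.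
by case: (De) => X /e_inj -> //; rewrite !inE.
Qed.

(** A functional on the reduced power is a functional on [Z^K] that kills
    the functions supported at one point. *)
Lemma no_functional_reduced_power (A : Type) (K : small) :
  ~ (exists X : small, measurable_cardinal X) ->
  no_functional (reduced_power A K).
Proof.
move=> no_measurable f q; have [x <-] := reduce_surj q.
apply: (@functional_eq0_of_null_points K (f \o @reduce A K)) => // i y yi /=.
suff -> : reduce A y = 0 by rewrite raddf0.
apply/reduce_eq0; apply: few_subset (few1 A i) => k /= yk.
by apply: contrapT => /yi.
Qed.

(** Each pair of elements of [B] contributes few coordinates at which an
    arbitrary lift of [g] fails to respect their difference, and there are
    only [|B * B|] pairs. *)
Lemma additive_lift_almost_everywhere (B : zmodType) (K : Type)
    (g : {additive B -> reduced_power (B * B) K}) :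
  exists s : B -> K -> int, (forall b, reduce _ (s b) = g b) /\
    few (B * B) [set k | ~ zmod_morphism (s^~ k)].
Proof.
have [s sP] := choice (fun b => reduce_surj (g b)).
exists s; split=> //.
pose err (b c : B) := s (b - c) - (s b - s c).
have /few_bigcup : forall t : bool + B * B, few (B * B)
    (if t is inr p then [set k | err p.1 p.2 k <> 0] else set0).
  case=> [_|[b c]]; first by exists (fun=> fun=> inl true) => k; rewrite inE.
  apply/reduce_eq0; rewrite [LHS]raddfB [X in _ - X = _]raddfB /= !sP -raddfB.
  exact: subrr.
apply: few_subset => k ns.
apply: contrapT => nerr; apply: ns => b c; apply: contrapT => ne.
apply: nerr; exists (inr (b, c)) => //= e0; apply: ne.
by apply/eqP; rewrite -subr_eq0; apply/eqP.
Qed.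

Lemma no_functional_not_weakly_reflective :
  ~ (exists X : small, measurable_cardinal X) ->
  ~ weakly_reflective no_functional.
Proof.
move=> no_measurable /(_ int)[B [l [LB lP]]].
pose K : small := set (nat -> bool + B * B).
pose G := reduced_power (B * B) K.
have [f fE] : exists f : {additive int -> G},
    f = (fun n : int => reduce _ (fun=> n)) :> (_ -> _).
  by apply: additive_of => m n; rewrite -raddfB.
have [g gl] := lP G (no_functional_reduced_power no_measurable) f.
have [s [sP s_add]] := additive_lift_almost_everywhere g.
have s1 : few (B * B) [set k : K | s (l 1) k <> 1].
  have : reduce (B * B) (s (l 1) - (fun=> 1)) = 0.
    by rewrite [LHS]raddfB /= sP -[g _]/((g \o l) 1) gl fE subrr.
  move=> /reduce_eq0; apply: few_subset => k sk /= E; apply: sk.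
  by apply/eqP; rewrite -subr_eq0; apply/eqP.
apply: (@not_few_powerset (B * B)); apply: few_subset (fewU s_add s1) => k _.
apply: contrapT => /not_orP[/contrapT s_addk s1k].
have [h hE] := additive_of s_addk.
by apply: s1k => /=; rewrite -[s _ k]/((s^~ k) (l 1)) -hE LB.
Qed.

Theorem proposition2p6
  (no_measurable : ~ exists X : small, measurable_cardinal X) :
  exists L : zmodType -> Prop,
    [/\ iso_closed L, product_closed L, retract_closed L
      & ~ weakly_reflective L].
Proof.
exists no_functional; split.
- exact: no_functional_iso.
- exact: no_functional_product.
- exact: no_functional_retract.
- exact: no_functional_not_weakly_reflective.
Qed.
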